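(* Let $A,B$ be $\Sigma^0_2$ sets such that $(A,B)$ is an Ahmad pair. Then $A$ has an Ahmad sequence.
   Context: $\le_e$ is enumeration reducibility: $A\le_e B$ iff $A=\Gamma(B):=\{x:\exists\text{ finite }D\subseteq B,\ \langle x,D\rangle\in\Gamma\}$ for some c.e. set $\Gamma$; $<_e$ as usual. $(\Gamma_e)_e$ is a standard listing of all c.e. sets (enumeration operators). $0'_e=\emptyset'$ is the enumeration jump of $\emptyset$; $\Sigma^0_2$ sets are those $\le_e 0'_e$; all sets considered are $\Sigma^0_2$. $(A,B)$ is an Ahmad pair if $A\not\le_e B$ and every $Z<_e A$ satisfies $Z\le_e B$. A computable function $f$ gives an Ahmad sequence $\{\Gamma_{f(n)}(0'_e)\}_n$ for $A$ if $\{\Gamma_{f(n)}(0'_e):n\in\omega\}=\{X\subseteq\omega: X<_e A\}$. *)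

(* Defs.v *)
From Stdlib Require Import Arith Lia Cantor.

Notation "⟨ x , y ⟩" := (Cantor.to_nat (x, y)) (at level 0, format "⟨ x ,  y ⟩").

(* Partial recursive functions of one argument; several arguments are packed
   with the Cantor pairing. *)
Inductive code : Type :=
| Zero : code
| Succ : code
| Fst  : code
| Snd  : code
| Pair : code -> code -> code
| Comp : code -> code -> code
| Prec : code -> code -> code
| Mu   : code -> code.

(* [prec_graph F G a n y]: h n = y, where h 0 = F a and
   h (n+1) = G ⟨a, ⟨n, h n⟩⟩, for partial functions given by their graphs. *)
Fixpoint prec_graph (F G : nat -> nat -> Prop) (a n y : nat) : Prop :=
  match n with
  | 0 => F a y
  | S m => exists r, prec_graph F G a m r /\ G ⟨a, ⟨m, r⟩⟩ y
  end.

(* [eval c x y]: the partial function with code c is defined at x, with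
   value y. *)
Fixpoint eval (c : code) (x y : nat) : Prop :=
  match c with
  | Zero => y = 0
  | Succ => y = S x
  | Fst => y = fst (Cantor.of_nat x)
  | Snd => y = snd (Cantor.of_nat x)
  | Pair f g => exists u v, eval f x u /\ eval g x v /\ y = ⟨u, v⟩
  | Comp f g => exists u, eval g x u /\ eval f u y
  | Prec f g =>
      prec_graph (eval f) (eval g) (fst (Cantor.of_nat x)) (snd (Cantor.of_nat x)) y
  | Mu f =>
      eval f ⟨x, y⟩ 0 /\ forall m, m < y -> exists k, eval f ⟨x, m⟩ (S k)
  end.

Fixpoint encode (c : code) : nat :=
  match c with
  | Zero => 0
  | Succ => 1
  | Fst => 2
  | Snd => 3
  | Pair f g => 4 + 4 * ⟨encode f, encode g⟩
  | Comp f g => 5 + 4 * ⟨encode f, encode g⟩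
  | Prec f g => 6 + 4 * ⟨encode f, encode g⟩
  | Mu f => 7 + 4 * encode f
  end.

Definition natset := nat -> Prop.

Definition set_eq (X Y : natset) : Prop := forall x, X x <-> Y x.

Definition empty : natset := fun _ => False.

Definition dom (c : code) : natset := fun x => exists y, eval c x y.

Definition ce (X : natset) : Prop := exists c, set_eq X (dom c).

Definition computable (f : nat -> nat) : Prop :=
  exists c, forall n, eval c n (f n).

(* The standard listing of the c.e. sets. *)
Definition W (e : nat) : natset := fun x => exists c, encode c = e /\ dom c x.

(* The finite set with canonical index u, where u is the sum of 2^z over its
   elements z. *)
Definition D (u : nat) : natset := fun z => Nat.testbit u z = true.

Definition enum_op (G B : natset) : natset :=
  fun x => exists u, (forall z, D u z -> B z) /\ G ⟨x, u⟩.

Definition Gamma (e : nat) (B : natset) : natset := enum_op (W e) B.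

Definition e_le (A B : natset) : Prop :=
  exists G, ce G /\ set_eq A (enum_op G B).

Definition e_lt (A B : natset) : Prop := e_le A B /\ ~ e_le B A.

Definition join (X Y : natset) : natset :=
  fun n => exists x, (n = 2 * x /\ X x) \/ (n = 2 * x + 1 /\ Y x).

Definition K (A : natset) : natset :=
  fun n => exists e x, n = ⟨e, x⟩ /\ Gamma e A x.

Definition e_jump (A : natset) : natset := join (K A) (fun n => ~ K A n).

Definition zero_jump : natset := e_jump empty.

Definition sigma2 (A : natset) : Prop := e_le A zero_jump.

Definition ahmad_pair (A B : natset) : Prop :=
  ~ e_le A B /\ forall Z, e_lt Z A -> e_le Z B.

(* Equality of the classes {Gamma_{f(n)}(0'_e) : n} and {X : X <_e A}, sets
   being identified when they have the same elements. *)
Definition ahmad_sequence (A : natset) (f : nat -> nat) : Prop :=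
  computable f /\
  forall X, (exists n, set_eq X (Gamma (f n) zero_jump)) <-> e_lt X A.

Lemma to_nat_pair_inj a b a' b' : ⟨a, b⟩ = ⟨a', b'⟩ -> a = a' /\ b = b'.
Proof.
  intros H. apply Cantor.to_nat_inj in H. now injection H.
Qed.

Lemma encode_inj c d : encode c = encode d -> c = d.
Proof.
  revert d.
  induction c; intros []; cbn [encode]; intros H; try lia; try reflexivity;
    try (match type of H with context [⟨?a, ?b⟩] =>
      let E := fresh in
      match type of H with _ = _ + 4 * ?t => assert (E : ⟨a, b⟩ = t) by lia end;
      apply to_nat_pair_inj in E; destruct E end; f_equal; auto).
  f_equal; apply IHc; lia.
Qed.

Lemma eval_functional c x y z : eval c x y -> eval c x z -> y = z.
Proof.
  revert x y z.
  induction c as [| | | |f IHf g IHg|f IHf g IHg|f IHf g IHg|f IHf];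
    intros x y z; cbn [eval]; try congruence.
  - intros (u & v & Hu & Hv & ->) (u' & v' & Hu' & Hv' & ->).
    now rewrite (IHf _ _ _ Hu Hu'), (IHg _ _ _ Hv Hv').
  - intros (u & Hu & Hy) (v & Hv & Hz).
    rewrite (IHg _ _ _ Hv Hu) in Hz. eauto.
  - generalize (fst (Cantor.of_nat x)) as a, (snd (Cantor.of_nat x)) as n.
    intros a n; revert y z.
    induction n as [|n IHn]; intros y z; cbn [prec_graph]; [eauto|].
    intros (r & Hr & Hy) (s & Hs & Hz).
    rewrite (IHn _ _ Hs Hr) in Hz. eauto.
  - intros [Hy Ly] [Hz Lz].
    destruct (lt_eq_lt_dec y z) as [[H|H]|H]; [|exact H|].
    + destruct (Lz _ H) as [k Hk]. discriminate (IHf _ _ _ Hy Hk).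
    + destruct (Ly _ H) as [k Hk]. discriminate (IHf _ _ _ Hz Hk).
Qed.

Lemma W_encode c : set_eq (W (encode c)) (dom c).
Proof.
  intros x; split.
  - intros (d & E & H). now rewrite <- (encode_inj _ _ E).
  - intros H. now exists c.
Qed.

(* Main.v *)
From Stdlib Require Import Arith Lia Cantor Classical.
Require Import Defs.

(** Since [(A, B)] is an Ahmad pair, [X <_e A] holds iff [X] is reducible to
    both [A] and [B], so it suffices to list the sets
    [Gamma_i(A) = Gamma_j(B)] uniformly.  Relative to the oracle [0'_e] both
    sides are enumerated in stages.  For each pair [⟨i, j⟩], enumerate [x] when
    it has appeared in [Gamma_i(A)] at a stage [m > x] at which the two sides
    agree on [[0, x]].  If the two sets are equal this gives the common set;
    otherwise a disagreement is permanent from some stage on and the result is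
    finite, hence still below [A] and [B]. *)

(** * Projections of the Cantor pairing *)

Notation pi1 x := (fst (Cantor.of_nat x)).
Notation pi2 x := (snd (Cantor.of_nat x)).

Lemma pi1_pair a b : pi1 ⟨a, b⟩ = a.
Proof. now rewrite Cantor.cancel_of_to. Qed.

Lemma pi2_pair a b : pi2 ⟨a, b⟩ = b.
Proof. now rewrite Cantor.cancel_of_to. Qed.

Lemma pair_pi x : ⟨pi1 x, pi2 x⟩ = x.
Proof. rewrite <- surjective_pairing. apply Cantor.cancel_to_of. Qed.

(** * Closure properties of the computable functions *)

Lemma computable_ext f g :
  computable f -> (forall x, f x = g x) -> computable g.
Proof. intros [c Hc] H. exists c. intros n. rewrite <- H. apply Hc. Qed.

(** Built uniformly in [n], so that the index of the code depends computably on [n]; [smn] uses it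
    to hard-wire a parameter. *)
Fixpoint const_code (n : nat) : code :=
  match n with 0 => Zero | S n => Comp Succ (const_code n) end.

Lemma eval_const_code n x y : eval (const_code n) x y <-> y = n.
Proof.
  revert y. induction n as [|n IH]; intros y; cbn [const_code eval]; [easy|].
  split.
  - intros (u & Hu & ->). f_equal. now apply IH.
  - intros ->. exists n. split; [now apply IH|easy].
Qed.

Lemma computable_const n : computable (fun _ => n).
Proof. exists (const_code n). intros x. now apply eval_const_code. Qed.

Lemma computable_pair f g :
  computable f -> computable g -> computable (fun e => ⟨f e, g e⟩).
Proof.
  intros [c Hc] [d Hd]. exists (Pair c d). intros n. cbn.
  exists (f n), (g n). auto.
Qed.

Lemma computable_comp f g :
  computable f -> computable g -> computable (fun e => f (g e)).
Proof.
  intros [c Hc] [d Hd]. exists (Comp c d). intros n. cbn. eauto.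
Qed.

Lemma computable_comp2 (h : nat -> nat -> nat) f g :
  computable (fun p => h (pi1 p) (pi2 p)) -> computable f -> computable g ->
  computable (fun e => h (f e) (g e)).
Proof.
  intros Hh Hf Hg.
  pose proof (computable_comp _ _ Hh (computable_pair _ _ Hf Hg)) as H.
  apply (computable_ext _ _ H). intros e. now rewrite pi1_pair, pi2_pair.
Qed.

Lemma computable_pi1 f : computable f -> computable (fun e => pi1 (f e)).
Proof.
  apply (computable_comp (fun e => pi1 e)). now exists Fst.
Qed.

Lemma computable_pi2 f : computable f -> computable (fun e => pi2 (f e)).
Proof.
  apply (computable_comp (fun e => pi2 e)). now exists Snd.
Qed.

Lemma computable_id : computable (fun e => e).
Proof.
  exists (Pair Fst Snd). intros n. cbn [eval].
  exists (pi1 n), (pi2 n). now rewrite pair_pi.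
Qed.

Lemma computable_S f : computable f -> computable (fun e => S (f e)).
Proof. apply (computable_comp S). now exists Succ. Qed.

Fixpoint prim_rec (b : nat) (s : nat -> nat -> nat) (n : nat) : nat :=
  match n with 0 => b | S n => s n (prim_rec b s n) end.

Lemma computable_rec (b n : nat -> nat) (s : nat -> nat -> nat -> nat) :
  computable b -> computable n ->
  computable (fun p => s (pi1 p) (pi1 (pi2 p)) (pi2 (pi2 p))) ->
  computable (fun e => prim_rec (b e) (s e) (n e)).
Proof.
  intros [cb Hb] Hn [cs Hs].
  (* [Prec] reads the parameter and the recursion depth from one pair, so the depth is first split
     off as a separate argument. *)
  apply (computable_comp2
    (fun a => prim_rec (b a) (s a)) (fun e => e) n);
    [|apply computable_id|exact Hn].
  exists (Prec cb cs). intros p. cbn [eval].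
  generalize (pi1 p) as a, (pi2 p) as k. clear p. intros a k.
  induction k as [|k IH]; cbn [prec_graph prim_rec]; [apply Hb|].
  eexists. split; [exact IH|].
  pose proof (Hs ⟨a, ⟨k, prim_rec (b a) (s a) k⟩⟩) as H.
  now rewrite pi2_pair, !pi1_pair, pi2_pair in H.
Qed.

(** A case distinction is a primitive recursion whose step ignores the previous value. *)
Lemma computable_case (n b : nat -> nat) (s : nat -> nat -> nat) :
  computable n -> computable b -> computable (fun p => s (pi1 p) (pi2 p)) ->
  computable (fun e => match n e with 0 => b e | S k => s e k end).
Proof.
  intros Hn Hb Hs.
  apply (computable_ext
    (fun e => prim_rec (b e) (fun k _ => s e k) (n e))).
  - apply (computable_rec b n (fun e k _ => s e k)); auto.
    apply (computable_comp2 s); [exact Hs|..];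
      repeat first [apply computable_pi1 | apply computable_pi2
        | apply computable_id].
  - intros e. now destruct (n e).
Qed.

Ltac comp_struct :=
  repeat first
    [ assumption
    | apply computable_id
    | apply computable_const
    | apply computable_pi1
    | apply computable_pi2
    | apply computable_S
    | apply computable_pair ].

Lemma computable_pred f : computable f -> computable (fun e => Nat.pred (f e)).
Proof.
  intros Hf.
  apply (computable_case f f (fun _ k => k)); comp_struct.
Qed.

Lemma computable_add f g :
  computable f -> computable g -> computable (fun e => f e + g e).
Proof.
  intros Hf Hg.
  apply (computable_ext (fun e =>
    prim_rec (g e) (fun _ r => S r) (f e))).
  - apply (computable_rec g f (fun _ _ r => S r)); comp_struct.
  - intros e. induction (f e) as [|k IH]; cbn; congruence.
Qed.

Lemma computable_sub f g :
  computable f -> computable g -> computable (fun e => f e - g e).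
Proof.
  intros Hf Hg.
  apply (computable_ext (fun e =>
    prim_rec (f e) (fun _ r => Nat.pred r) (g e))).
  - apply (computable_rec f g (fun _ _ r => Nat.pred r));
      try apply computable_pred; comp_struct.
  - intros e. induction (g e) as [|k IH]; cbn [prim_rec]; lia.
Qed.

Lemma computable_double f : computable f -> computable (fun e => 2 * f e).
Proof.
  intros Hf. apply (computable_ext (fun e => f e + f e)).
  - now apply computable_add.
  - intros e. lia.
Qed.

Lemma computable_quadruple f : computable f -> computable (fun e => 4 * f e).
Proof.
  intros Hf. apply (computable_ext (fun e => 2 * (2 * f e))).
  - now repeat apply computable_double.
  - intros e. lia.
Qed.

Lemma computable_odd f :
  computable f -> computable (fun e => Nat.b2n (Nat.odd (f e))).
Proof.
  intros Hf.
  apply (computable_ext (fun e =>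
    prim_rec 0 (fun _ r => 1 - r) (f e))).
  - apply (computable_rec (fun _ => 0) f (fun _ _ r => 1 - r));
      try apply computable_sub; comp_struct.
  - intros e. induction (f e) as [|k IH]; [easy|]. cbn [prim_rec].
    rewrite IH, Nat.odd_succ, <- Nat.negb_odd. now destruct (Nat.odd k).
Qed.

(** Passing from [k] to [S k] raises the half by the parity of [k]. *)
Lemma computable_div2 f :
  computable f -> computable (fun e => Nat.div2 (f e)).
Proof.
  intros Hf.
  apply (computable_ext (fun e => prim_rec 0
    (fun k r => r + Nat.b2n (Nat.odd k)) (f e))).
  - apply (computable_rec (fun _ => 0) f
      (fun _ k r => r + Nat.b2n (Nat.odd k)));
      try apply computable_add; try apply computable_odd; comp_struct.
  - intros e. induction (f e) as [|k IH]; [easy|]. cbn [prim_rec]. rewrite IH.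
    pose proof (Nat.div2_odd k) as H1. pose proof (Nat.div2_odd (S k)) as H2.
    rewrite Nat.odd_succ, <- Nat.negb_odd in H2.
    destruct (Nat.odd k); cbn [Nat.b2n negb] in *; lia.
Qed.

Lemma computable_testbit f g :
  computable f -> computable g ->
  computable (fun e => Nat.b2n (Nat.testbit (f e) (g e))).
Proof.
  intros Hf Hg.
  apply (computable_ext (fun e => Nat.b2n (Nat.odd
    (prim_rec (f e) (fun _ r => Nat.div2 r) (g e))))).
  - apply computable_odd, (computable_rec f g (fun _ _ r => Nat.div2 r));
      try apply computable_div2; comp_struct.
  - intros e. rewrite Nat.testbit_odd. do 2 f_equal.
    induction (g e) as [|k IH]; [easy|].
    cbn [prim_rec]. now rewrite IH.
Qed.

Lemma computable_const_code_encode :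
  computable (fun n => encode (const_code n)).
Proof.
  apply (computable_ext (fun n =>
    (* [1] is the index of [Succ], so the step turns the index of a code into that of its
       composition with [Succ]. *)
    prim_rec 0 (fun _ r => 5 + 4 * ⟨1, r⟩) n)).
  - apply (computable_rec (fun _ => 0) (fun n => n)
      (fun _ _ r => 5 + 4 * ⟨1, r⟩)); try apply computable_add;
      try apply computable_quadruple; comp_struct.
  - intros n. induction n as [|n IH]; [easy|].
    cbn [prim_rec const_code encode]. congruence.
Qed.

(** * Decidable predicates *)

(** Any nonzero value counts as true, so that disjunction becomes addition and a bounded existential
    a finite sum. *)
Definition decidable (P : natset) : Prop :=
  exists f, computable f /\ forall e, P e <-> f e <> 0.

Lemma decidable_ext P Q : decidable P -> set_eq P Q -> decidable Q.
Proof.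
  intros (f & Hf & H) E. exists f. split; [exact Hf|]. intros e.
  now rewrite <- (E e).
Qed.

Lemma decidable_comp2 (P : nat -> nat -> Prop) f g :
  decidable (fun p => P (pi1 p) (pi2 p)) -> computable f -> computable g ->
  decidable (fun e => P (f e) (g e)).
Proof.
  intros (h & Hh & H) Hf Hg. exists (fun e => h ⟨f e, g e⟩). split.
  - apply computable_comp; [exact Hh|now apply computable_pair].
  - intros e. specialize (H ⟨f e, g e⟩). now rewrite pi1_pair, pi2_pair in H.
Qed.

Lemma decidable_not P : decidable P -> decidable (fun e => ~ P e).
Proof.
  intros (f & Hf & H). exists (fun e => 1 - f e). split.
  - apply computable_sub; comp_struct.
  - intros e. rewrite H. lia.
Qed.

Lemma decidable_or P Q :
  decidable P -> decidable Q -> decidable (fun e => P e \/ Q e).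
Proof.
  intros (f & Hf & H) (g & Hg & H'). exists (fun e => f e + g e). split.
  - apply computable_add; comp_struct.
  - intros e. rewrite H, H'. lia.
Qed.

Lemma decidable_and P Q :
  decidable P -> decidable Q -> decidable (fun e => P e /\ Q e).
Proof.
  intros HP HQ.
  apply (decidable_ext (fun e => ~ (~ P e \/ ~ Q e))).
  - apply decidable_not, decidable_or; now apply decidable_not.
  - intros e. tauto.
Qed.

Lemma decidable_imp P Q :
  decidable P -> decidable Q -> decidable (fun e => P e -> Q e).
Proof.
  intros HP HQ.
  apply (decidable_ext (fun e => ~ P e \/ Q e)).
  - apply decidable_or; [now apply decidable_not|exact HQ].
  - intros e. tauto.
Qed.

Lemma decidable_iff P Q :
  decidable P -> decidable Q -> decidable (fun e => P e <-> Q e).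
Proof. intros HP HQ. apply decidable_and; now apply decidable_imp. Qed.

Lemma decidable_lt f g :
  computable f -> computable g -> decidable (fun e => f e < g e).
Proof.
  intros Hf Hg. exists (fun e => g e - f e). split.
  - now apply computable_sub.
  - intros e. lia.
Qed.

Lemma decidable_neq0 f : computable f -> decidable (fun e => f e <> 0).
Proof. intros Hf. now exists f. Qed.

Lemma decidable_D f g :
  computable f -> computable g -> decidable (fun e => D (f e) (g e)).
Proof.
  intros Hf Hg. exists (fun e => Nat.b2n (Nat.testbit (f e) (g e))). split.
  - now apply computable_testbit.
  - intros e. unfold D. destruct (Nat.testbit (f e) (g e)); cbn; easy.
Qed.

Lemma decidable_bex (b : nat -> nat) (P : nat -> nat -> Prop) :
  computable b -> decidable (fun p => P (pi1 p) (pi2 p)) ->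
  decidable (fun e => exists k, k < b e /\ P e k).
Proof.
  intros Hb (f & Hf & H).
  exists (fun e =>
    prim_rec 0 (fun k r => r + f ⟨e, k⟩) (b e)). split.
  - apply (computable_rec (fun _ => 0) b (fun e k r => r + f ⟨e, k⟩));
      try apply computable_add; try apply (computable_comp f); comp_struct.
  - intros e. induction (b e) as [|k IH]; cbn [prim_rec].
    + split; [intros (k & Hk & _); lia|easy].
    + specialize (H ⟨e, k⟩). rewrite pi1_pair, pi2_pair in H. split.
      * intros (k' & Hk & HP).
        destruct (Nat.eq_dec k' k) as [->|N]; [apply H in HP; lia|].
        assert (exists k0, k0 < k /\ P e k0) as HE
          by (exists k'; split; [lia|easy]).
        apply IH in HE. lia.
      * intros HN. destruct (Nat.eq_dec (f ⟨e, k⟩) 0) as [E|E].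
        -- rewrite E in HN. rewrite Nat.add_0_r in HN.
           apply IH in HN. destruct HN as (k' & Hk & HP).
           exists k'. split; [lia|easy].
        -- exists k. split; [lia|now apply H].
Qed.

Lemma decidable_ball (b : nat -> nat) (P : nat -> nat -> Prop) :
  computable b -> decidable (fun p => P (pi1 p) (pi2 p)) ->
  decidable (fun e => forall k, k < b e -> P e k).
Proof.
  intros Hb HP.
  apply (decidable_ext (fun e => ~ exists k, k < b e /\ ~ P e k)).
  - apply decidable_not, (decidable_bex b (fun e k => ~ P e k)); [easy|].
    now apply decidable_not.
  - intros e. split.
    + intros H k Hk. apply NNPP. intros N. eauto.
    + intros H (k & Hk & N). auto.
Qed.

Ltac decide_struct :=
  repeat first
    [ assumption
    | simple apply computable_const
    | simple apply computable_id
    | simple apply computable_pi1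
    | simple apply computable_pi2
    | simple apply computable_S
    | simple apply computable_pair
    | simple apply computable_double
    | simple apply computable_quadruple
    | simple apply computable_add
    | simple apply decidable_D
    | simple apply decidable_lt
    | simple apply decidable_bex
    | simple apply decidable_ball
    | simple apply decidable_and
    | simple apply decidable_iff
    | simple apply decidable_or
    | simple apply decidable_imp ].

(** * Normal form of the c.e. sets *)

(** The projection is the domain of an unbounded search for a zero of the function deciding the
    negation of [P]. *)
Lemma ce_projection (P : nat -> nat -> Prop) :
  decidable (fun p => P (pi1 p) (pi2 p)) -> ce (fun x => exists t, P x t).
Proof.
  intros HP. destruct (decidable_not _ HP) as (f & [c Hc] & H).
  exists (Mu c). intros x. unfold dom. cbn [eval].
  assert (E : forall t, P x t <-> f ⟨x, t⟩ = 0).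
  { intros t. specialize (H ⟨x, t⟩). rewrite pi1_pair, pi2_pair in H.
    destruct (classic (P x t)); tauto || lia. }
  split.
  - intros [t Ht]. apply E in Ht.
    (* [Mu] stops only at the least zero, so the induction descends to it from an arbitrary
       witness. *)
    induction t as [t IH] using lt_wf_ind.
    destruct (classic (exists m, m < t /\ f ⟨x, m⟩ = 0)) as [(m & L & Hm)|N].
    + eauto.
    + exists t. split; [rewrite <- Ht; apply Hc|].
      intros m L. exists (Nat.pred (f ⟨x, m⟩)).
      rewrite Nat.succ_pred; [apply Hc|]. eauto.
  - intros (t & Ht & _). exists t. apply E.
    exact (eval_functional _ _ _ _ (Hc _) Ht).
Qed.

(* [T x s] is the result of running the code on [x] for [s] steps:
   0 if it has not yet halted, [S y] if it has halted with value [y]. *)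
Record step_function (F : nat -> nat -> Prop) (T : nat -> nat -> nat) := {
  step_computable : computable (fun p => T (pi1 p) (pi2 p));
  step_mono x s t y : T x s = S y -> s <= t -> T x t = S y;
  step_spec x y : F x y <-> exists s, T x s = S y }.

Lemma step_function_total c f :
  (forall x y, eval c x y <-> y = f x) -> exists T, step_function (eval c) T.
Proof.
  intros H. exists (fun x _ => S (f x)). split.
  - apply computable_S, (computable_comp f); [|comp_struct].
    exists c. intros n. now apply H.
  - easy.
  - intros x y. rewrite H. split; [intros ->; now exists 0|].
    intros [_ E]. congruence.
Qed.

Lemma step_function_pair F G T U :
  step_function F T -> step_function G U ->
  exists V, step_function
    (fun x y => exists u v, F x u /\ G x v /\ y = ⟨u, v⟩) V.
Proof.
  intros HT HU.
  exists (fun x s => match T x s with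
    | 0 => 0
    | S u => match U x s with 0 => 0 | S v => S ⟨u, v⟩ end end).
  split.
  - apply (computable_case (fun p => T (pi1 p) (pi2 p)) (fun _ => 0)
      (fun p u => match U (pi1 p) (pi2 p) with 0 => 0 | S v => S ⟨u, v⟩ end)).
    + apply HT.
    + comp_struct.
    + apply (computable_case (fun p => U (pi1 (pi1 p)) (pi2 (pi1 p)))
        (fun _ => 0) (fun p v => S ⟨pi2 p, v⟩)); comp_struct.
      apply (computable_comp2 _ _ _ (step_computable _ _ HU)); comp_struct.
  - intros x s t y E L.
    destruct (T x s) eqn:E1; [easy|]. destruct (U x s) eqn:E2; [easy|].
    now rewrite (step_mono _ _ HT _ _ _ _ E1 L), (step_mono _ _ HU _ _ _ _ E2 L).
  - intros x y. split.
    + intros (u & v & Hu & Hv & ->).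
      apply (step_spec _ _ HT) in Hu. apply (step_spec _ _ HU) in Hv.
      destruct Hu as [s Hs], Hv as [t Ht]. exists (s + t).
      rewrite (step_mono _ _ HT _ _ (s + t) _ Hs ltac:(lia)).
      now rewrite (step_mono _ _ HU _ _ (s + t) _ Ht ltac:(lia)).
    + intros [s E].
      destruct (T x s) as [|u] eqn:E1; [easy|].
      destruct (U x s) as [|v] eqn:E2; [easy|].
      exists u, v. split; [|split].
      * apply (step_spec _ _ HT). eauto.
      * apply (step_spec _ _ HU). eauto.
      * congruence.
Qed.

Lemma step_function_comp F G T U :
  step_function F T -> step_function G U ->
  exists V, step_function (fun x y => exists u, G x u /\ F u y) V.
Proof.
  intros HT HU.
  exists (fun x s => match U x s with 0 => 0 | S u => T u s end).
  split.
  - apply (computable_case (fun p => U (pi1 p) (pi2 p)) (fun _ => 0)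
      (fun p u => T u (pi2 p))).
    + apply HU.
    + comp_struct.
    + apply (computable_comp2 _ _ _ (step_computable _ _ HT)); comp_struct.
  - intros x s t y E L.
    destruct (U x s) eqn:E1; [easy|].
    rewrite (step_mono _ _ HU _ _ _ _ E1 L).
    exact (step_mono _ _ HT _ _ _ _ E L).
  - intros x y. split.
    + intros (u & Hu & Hv).
      apply (step_spec _ _ HU) in Hu. apply (step_spec _ _ HT) in Hv.
      destruct Hu as [s Hs], Hv as [t Ht]. exists (s + t).
      rewrite (step_mono _ _ HU _ _ (s + t) _ Hs ltac:(lia)).
      now rewrite (step_mono _ _ HT _ _ (s + t) _ Ht ltac:(lia)).
    + intros [s E].
      destruct (U x s) as [|u] eqn:E1; [easy|].
      exists u. split.
      * apply (step_spec _ _ HU). eauto.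
      * apply (step_spec _ _ HT). eauto.
Qed.

(** All levels of the recursion run with the same budget [s]. A larger budget preserves the values
    already found, so a sum of budgets suffices. *)
Lemma step_function_prec F G T U :
  step_function F T -> step_function G U ->
  exists V, step_function (fun x y => prec_graph F G (pi1 x) (pi2 x) y) V.
Proof.
  intros HT HU.
  set (R a s := prim_rec (T a s)
    (fun k r => match r with 0 => 0 | S r => U ⟨a, ⟨k, r⟩⟩ s end)).
  assert (Rmono : forall a s t n y, R a s n = S y -> s <= t -> R a t n = S y).
  { intros a s t n. induction n as [|n IH]; intros y E L; cbn in *.
    - exact (step_mono _ _ HT _ _ _ _ E L).
    - fold (R a s n) in E. fold (R a t n).
      destruct (R a s n) as [|r]; [easy|]. rewrite (IH r eq_refl L).
      exact (step_mono _ _ HU _ _ _ _ E L). }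
  exists (fun x s => R (pi1 x) s (pi2 x)). split.
  - apply (computable_rec (fun p => T (pi1 (pi1 p)) (pi2 p))
      (fun p => pi2 (pi1 p)) (fun p k r => match r with
        0 => 0 | S r => U ⟨pi1 (pi1 p), ⟨k, r⟩⟩ (pi2 p) end)).
    + apply (computable_comp2 _ _ _ (step_computable _ _ HT)); comp_struct.
    + comp_struct.
    + apply (computable_case (fun q => pi2 (pi2 q)) (fun _ => 0)
        (fun q r => U ⟨pi1 (pi1 (pi1 q)), ⟨pi1 (pi2 q), r⟩⟩ (pi2 (pi1 q))));
        comp_struct.
      apply (computable_comp2 _ _ _ (step_computable _ _ HU)); comp_struct.
  - eauto.
  - intros x. generalize (pi1 x) as a, (pi2 x) as n. clear x. intros a n.
    induction n as [|n IH]; intros y; cbn [prec_graph].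
    + apply (step_spec _ _ HT).
    + split.
      * intros (r & Hr & Hy). apply IH in Hr. apply (step_spec _ _ HU) in Hy.
        destruct Hr as [s Hs], Hy as [t Ht]. exists (s + t).
        cbn. fold (R a (s + t) n).
        rewrite (Rmono _ _ (s + t) _ _ Hs ltac:(lia)).
        apply (step_mono _ _ HU _ _ _ _ Ht). lia.
      * intros [s E]. cbn in E. fold (R a s n) in E.
        destruct (R a s n) as [|r] eqn:Er; [easy|].
        exists r. split; [apply IH; eauto|]. apply (step_spec _ _ HU). eauto.
Qed.

(** By monotonicity the finitely many stages can be added up to one common stage. *)
Lemma bounded_uniform (P : nat -> nat -> Prop) b :
  (forall z s t, P z s -> s <= t -> P z t) ->
  (forall z, z < b -> exists s, P z s) -> exists s, forall z, z < b -> P z s.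
Proof.
  intros M. induction b as [|b IH]; intros H.
  - exists 0. lia.
  - destruct IH as [s Hs]; [auto|]. destruct (H b ltac:(lia)) as [t Ht].
    exists (s + t). intros z L.
    destruct (Nat.eq_dec z b) as [->|N].
    + apply (M _ t); [easy|lia].
    + apply (M _ s); [apply Hs|]; lia.
Qed.

(* The search state is 0 while all arguments tried so far gave a positive
   value, 1 if it is blocked by an undetermined value, and [y + 2] once the
   zero [y] has been found. *)
Definition mu_step (T : nat -> nat -> nat) (x s k r : nat) : nat :=
  match r with
  | 0 => match T ⟨x, k⟩ s with
    | 0 => 1
    | S v => match v with 0 => S (S k) | S _ => 0 end end
  | S r => S r
  end.

Definition mu_search (T : nat -> nat -> nat) (x s : nat) : nat -> nat :=
  prim_rec 0 (mu_step T x s).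

Lemma mu_search_S T x s n :
  mu_search T x s (S n) = mu_step T x s n (mu_search T x s n).
Proof. reflexivity. Qed.

Lemma mu_search_0 T x s n :
  mu_search T x s n = 0 <->
  forall m, m < n -> exists v, T ⟨x, m⟩ s = S (S v).
Proof.
  induction n as [|n IH].
  - split; [lia|easy].
  - rewrite mu_search_S. unfold mu_step.
    destruct (mu_search T x s n) as [|r].
    + split.
      * intros E m L.
        destruct (T ⟨x, n⟩ s) as [|[|v]] eqn:ET; [easy..|].
        destruct (Nat.eq_dec m n) as [->|N]; [eauto|].
        apply IH; [easy|lia].
      * intros H. destruct (H n ltac:(lia)) as [v ->]. easy.
    + split; [easy|]. intros H. apply IH. intros m L. apply H. lia.
Qed.

Lemma mu_search_found T x s n y :
  mu_search T x s n = S (S y) <->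
  y < n /\ T ⟨x, y⟩ s = 1 /\
  forall m, m < y -> exists v, T ⟨x, m⟩ s = S (S v).
Proof.
  induction n as [|n IH].
  - split; [easy|lia].
  - rewrite mu_search_S. unfold mu_step.
    destruct (mu_search T x s n) as [|r] eqn:E.
    + assert (E' := proj1 (mu_search_0 T x s n) E).
      assert (Hlt : forall k, k < n -> T ⟨x, k⟩ s <> 1).
      { intros k L. destruct (E' k L) as [v ->]. easy. }
      split.
      * destruct (T ⟨x, n⟩ s) as [|[|v]] eqn:ET; intros H; try easy.
        injection H as <-. auto.
      * intros (L & Hy & _).
        destruct (Nat.eq_dec y n) as [->|N]; [now rewrite Hy|].
        exfalso. apply (Hlt y); [lia|easy].
    + rewrite IH. split.
      * intros (L & H). split; [lia|easy].
      * intros (L & Hy & H). split; [|easy].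
        destruct (Nat.eq_dec y n) as [->|N]; [|lia].
        rewrite (proj2 (mu_search_0 T x s n) H) in E. easy.
Qed.

Lemma step_function_mu F T :
  step_function F T ->
  exists V, step_function (fun x y => F ⟨x, y⟩ 0 /\
    forall m, m < y -> exists k, F ⟨x, m⟩ (S k)) V.
Proof.
  (* [s] bounds both the candidates tried and the steps spent on each. [Nat.pred] sends the states 0
     and 1 to no result, and [y + 2] to [S y]. *)
  intros HT. exists (fun x s => Nat.pred (mu_search T x s s)).
  assert (E : forall n y, Nat.pred n = S y <-> n = S (S y)) by lia.
  split.
  - apply computable_pred.
    apply (computable_rec (fun _ => 0) (fun p => pi2 p)
      (fun p => mu_step T (pi1 p) (pi2 p))); comp_struct.
    apply (computable_case (fun q => pi2 (pi2 q))
      (fun q => match T ⟨pi1 (pi1 q), pi1 (pi2 q)⟩ (pi2 (pi1 q)) with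
          | 0 => 1
          | S v => match v with 0 => S (S (pi1 (pi2 q))) | S _ => 0 end end)
      (fun _ r => S r)); comp_struct.
    apply (computable_case
      (fun q => T ⟨pi1 (pi1 q), pi1 (pi2 q)⟩ (pi2 (pi1 q))) (fun _ => 1)
      (fun q v => match v with 0 => S (S (pi1 (pi2 q))) | S _ => 0 end));
      comp_struct.
    + apply (computable_comp2 _ _ _ (step_computable _ _ HT)); comp_struct.
    + apply (computable_case (fun q => pi2 q)
        (fun q => S (S (pi1 (pi2 (pi1 q))))) (fun _ _ => 0)); comp_struct.
  - intros x s t y. rewrite !E, !mu_search_found. intros (L & Hy & H) L'.
    split; [lia|]. split; [exact (step_mono _ _ HT _ _ _ _ Hy L')|].
    intros m Hm. destruct (H m Hm) as [v Hv]. exists v.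
    exact (step_mono _ _ HT _ _ _ _ Hv L').
  - intros x y. split.
    + intros [H0 H]. apply (step_spec _ _ HT) in H0. destruct H0 as [s Hs].
      destruct (bounded_uniform
        (fun m t => exists k, T ⟨x, m⟩ t = S (S k)) y) as [t Ht].
      * intros z a b [k Hk] L. exists k. exact (step_mono _ _ HT _ _ _ _ Hk L).
      * intros z L. destruct (H z L) as [k Hk].
        apply (step_spec _ _ HT) in Hk. destruct Hk. eauto.
      * exists (S (y + s + t)). rewrite E, mu_search_found.
        split; [lia|]. split; [apply (step_mono _ _ HT _ _ _ _ Hs); lia|].
        intros m L. destruct (Ht m L) as [k Hk]. exists k.
        apply (step_mono _ _ HT _ _ _ _ Hk). lia.
    + intros [s Hs]. rewrite E, mu_search_found in Hs.
      destruct Hs as (_ & Hy & H).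
      split; [apply (step_spec _ _ HT); eauto|].
      intros m L. destruct (H m L) as [k Hk]. exists k.
      apply (step_spec _ _ HT). eauto.
Qed.

Lemma step_function_code c : exists T, step_function (eval c) T.
Proof.
  induction c as [| | | |f [T HT] g [U HU]|f [T HT] g [U HU]
    |f [T HT] g [U HU]|f [T HT]].
  - now apply (step_function_total _ (fun _ => 0)).
  - now apply (step_function_total _ S).
  - now apply (step_function_total _ (fun x => pi1 x)).
  - now apply (step_function_total _ (fun x => pi2 x)).
  - exact (step_function_pair _ _ _ _ HT HU).
  - exact (step_function_comp _ _ _ _ HT HU).
  - exact (step_function_prec _ _ _ _ HT HU).
  - exact (step_function_mu _ _ HT).
Qed.

Lemma ce_stages X :
  ce X -> exists P : nat -> nat -> Prop,
    decidable (fun p => P (pi1 p) (pi2 p)) /\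
    (forall x s t, P x s -> s <= t -> P x t) /\
    (forall x, X x <-> exists s, P x s).
Proof.
  intros [c Hc]. destruct (step_function_code c) as [T HT].
  exists (fun x s => T x s <> 0). split; [|split].
  - apply decidable_neq0, HT.
  - intros x s t H L. destruct (T x s) as [|y] eqn:E; [easy|].
    now rewrite (step_mono _ _ HT _ _ _ _ E L).
  - intros x. rewrite (Hc x). split.
    + intros [y Hy]. apply (step_spec _ _ HT) in Hy. destruct Hy as [s Hs].
      exists s. now rewrite Hs.
    + intros [s Hs]. exists (Nat.pred (T x s)). apply (step_spec _ _ HT).
      exists s. lia.
Qed.

(** * Enumeration reducibility *)

(** The position of a set bit is at most the binary logarithm of [u]. Quantifiers over [D u] can
    therefore be bounded by [u], which keeps the stage predicates decidable. *)
Lemma D_lt u z : D u z -> z < u.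
Proof.
  unfold D. intros H. destruct (Nat.eq_dec u 0) as [->|N].
  - now rewrite Nat.bits_0 in H.
  - destruct (Nat.lt_ge_cases (Nat.log2 u) z) as [L|L].
    + now rewrite Nat.bits_above_log2 in H.
    + pose proof (Nat.log2_lt_lin u). lia.
Qed.

Lemma D_0 z : ~ D 0 z.
Proof. unfold D. now rewrite Nat.bits_0. Qed.

(** A classical existence statement: [X] is arbitrary, and [u] is not computed from [b]. *)
Lemma bounded_set_code (X : natset) b :
  exists u, forall z, D u z <-> z < b /\ X z.
Proof.
  induction b as [|b [u Hu]].
  - exists 0. intros z. split; [intros H; now apply D_0 in H|lia].
  - destruct (classic (X b)) as [HX|HX].
    + exists (Nat.setbit u b). intros z. unfold D in *.
      rewrite Nat.setbit_eqb, Bool.orb_true_iff, Nat.eqb_eq, Hu.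
      split.
      * intros [<-|[L Hz]]; split; auto; lia.
      * intros [L Hz]. destruct (Nat.eq_dec z b); [auto|].
        right. split; [lia|easy].
    + exists u. intros z. rewrite Hu. split; intros [L Hz].
      * split; [lia|easy].
      * split; [|easy]. enough (z <> b) by lia. now intros ->.
Qed.

Lemma enum_op_ext G H B C :
  set_eq G H -> set_eq B C -> set_eq (enum_op G B) (enum_op H C).
Proof.
  intros EG EB x. split; intros (u & Hu & Hx); exists u; split;
    try (intros z Hz; apply EB); auto; now apply EG.
Qed.

Lemma e_le_Gamma X A : e_le X A <-> exists e, set_eq X (Gamma e A).
Proof.
  split.
  - intros (G & [c Hc] & HX). exists (encode c). intros x.
    rewrite (HX x). apply enum_op_ext; [|easy].
    intros y. now rewrite (Hc y), (W_encode c y).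
  - intros [e HX]. destruct (classic (exists c, encode c = e)) as [[c <-]|N].
    + exists (W (encode c)). split; [|exact HX]. exists c. apply W_encode.
    (* Were [e] the index of no code, [W e] would be empty; the empty set is c.e. as the projection
       of an empty relation, whence the dummy [t]. *)
    + exists (fun _ => exists t : nat, False). split.
      * apply (ce_projection (fun _ _ => False)). exists (fun _ => 0).
        split; [comp_struct|easy].
      * intros x. rewrite (HX x).
        split; [intros (u & _ & c & Hc & _); exfalso; eauto|].
        intros (u & _ & _ & []).
Qed.

(** The code of a bounded set is hard-wired into an operator that enumerates it whatever the
    premise. *)
Lemma e_le_bounded (X A : natset) b : (forall x, X x -> x < b) -> e_le X A.
Proof.
  intros Hb. destruct (bounded_set_code X b) as [u Hu].
  exists (fun p => exists t : nat, D u (pi1 p)). split.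
  - apply (ce_projection (fun p _ => D u (pi1 p))). decide_struct.
  - intros x. split.
    + intros Hx. exists 0. split; [intros z Hz; now apply D_0 in Hz|].
      exists 0. rewrite pi1_pair. apply Hu. auto.
    + intros (v & _ & _ & H). rewrite pi1_pair in H. now apply Hu in H.
Qed.

(** Operators compose: [⟨x, w⟩] is enumerated when some axiom [⟨x, u⟩] of [G] has every element of
    [D u] supplied by an axiom of [H] with premise inside [D w]. The stage bound [t] makes this a
    projection of a decidable relation. *)
Lemma e_le_trans A B C : e_le A B -> e_le B C -> e_le A C.
Proof.
  intros (G & HG & EA) (H & HH & EB).
  destruct (ce_stages G HG) as (P & Pdec & Pmono & PG).
  destruct (ce_stages H HH) as (Q & Qdec & Qmono & QH).
  set (V z w t := exists v, v < t /\ Q ⟨z, v⟩ t /\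
    forall k, k < v -> D v k -> D w k).
  set (R p t := exists u, u < t /\ P ⟨pi1 p, u⟩ t /\
    forall z, z < u -> D u z -> V z (pi2 p) t).
  assert (Vmono : forall z w s t, V z w s -> s <= t -> V z w t).
  { intros z w s t (v & L & Hv & Hs) L'. exists v.
    split; [lia|]. split; [eauto|easy]. }
  exists (fun p => exists t, R p t). split.
  - apply ce_projection. unfold R, V. decide_struct.
    + now apply (decidable_comp2 P); decide_struct.
    + now apply (decidable_comp2 Q); decide_struct.
  - intros x. rewrite (EA x). split.
    + intros (u & Hu & Hx). apply PG in Hx. destruct Hx as [s Hs].
      (* The premises are first required only to lie in [C]; the code [w] can be chosen once a
         common stage bounds them all. *)
      assert (HV : exists t, forall z, z < u ->
        D u z -> exists v, v < t /\ Q ⟨z, v⟩ t /\ forall k, D v k -> C k).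
      { apply (bounded_uniform (fun z t => D u z ->
          exists v, v < t /\ Q ⟨z, v⟩ t /\ forall k, D v k -> C k)).
        - intros z t t' H1 L Hz. destruct (H1 Hz) as (v & L' & Hv & HC).
          exists v. split; [lia|]. eauto.
        - intros z _. destruct (classic (D u z)) as [Hz|Hz]; [|now exists 0].
          apply Hu, EB in Hz. destruct Hz as (v & HC & Hv).
          apply QH in Hv. destruct Hv as [t Ht].
          exists (S (v + t)). intros _. exists v. split; [lia|].
          split; [apply (Qmono _ t); [easy|lia]|easy]. }
      (* [m] exceeds [u] and both stages, hence every element of the premises involved. All of [C]
         below [m] then serves as the single premise. *)
      destruct HV as [t Ht]. set (m := S (u + s + t)).
      destruct (bounded_set_code C m) as [w Hw]. exists w. split.
      * intros z Hz. now apply Hw in Hz.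
      * exists m, u. rewrite pi1_pair, pi2_pair. split; [lia|].
        split; [apply (Pmono _ s); [easy|lia]|].
        intros z L Hz. destruct (Ht z L Hz) as (v & L' & Hv & HC).
        exists v. split; [lia|]. split; [apply (Qmono _ t); [easy|lia]|].
        intros k Lk Hk. apply Hw. split; [lia|auto].
    + intros (w & Hw & t & u & _ & Hx & Hu).
      rewrite pi1_pair in Hx. rewrite pi2_pair in Hu.
      exists u. split; [|apply PG; eauto].
      intros z Hz. apply EB.
      destruct (Hu z (D_lt _ _ Hz) Hz) as (v & _ & Hv & Hs).
      exists v. split; [|apply QH; eauto].
      intros k Hk. apply Hw, Hs; [now apply D_lt|easy].
Qed.

(** The parameter is hard-wired by composing [c] with a code for the map taking [x] to [⟨n, x⟩];
    [Pair Fst Snd] is the identity. *)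
Lemma smn c :
  exists f, computable f /\ forall n x, W (f n) x <-> dom c ⟨n, x⟩.
Proof.
  exists (fun n => encode (Comp c (Pair (const_code n) (Pair Fst Snd)))). split.
  - cbn [encode].
    pose proof computable_const_code_encode. decide_struct.
  - intros n x. rewrite (W_encode _ x). unfold dom. cbn [eval]. split.
    + intros (y & v & (u & w & Hu & (z & z' & -> & -> & ->) & ->) & Hy).
      apply eval_const_code in Hu. subst u. rewrite pair_pi in Hy. eauto.
    + intros [y Hy]. exists y, ⟨n, x⟩. split; [|exact Hy].
      exists n, x. split; [now apply eval_const_code|].
      split; [|easy]. exists (pi1 x), (pi2 x). now rewrite pair_pi.
Qed.

(** * Approximations relative to the oracle *)

Lemma zero_jump_even k : zero_jump (2 * k) <-> K empty k.
Proof.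
  unfold zero_jump, e_jump, join. split.
  - intros (x & [[E H]|[E H]]); [|lia]. now replace k with x by lia.
  - intros H. exists k. auto.
Qed.

Lemma zero_jump_odd k : zero_jump (2 * k + 1) <-> ~ K empty k.
Proof.
  unfold zero_jump, e_jump, join. split.
  - intros (x & [[E H]|[E H]]); [lia|]. now replace k with x by lia.
  - intros H. exists k. auto.
Qed.

(* [5 + 4 * ⟨i, 2⟩] is the index of [Comp c Fst] when [i] is that of [c]. *)
Definition W_query (i y : nat) : nat := ⟨5 + 4 * ⟨i, 2⟩, y⟩.

(* The oracle thus replaces a universal machine. *)
Lemma zero_jump_W_query i y : zero_jump (2 * W_query i y) <-> W i y.
Proof.
  rewrite zero_jump_even. split.
  - intros (e & x & E & u & _ & d & Hd & z & Hz).
    apply to_nat_pair_inj in E. destruct E as [<- <-].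
    destruct d as [| | | |f g|f g|f g|f]; cbn [encode] in Hd; try lia.
    assert (E : ⟨encode f, encode g⟩ = ⟨i, 2⟩) by lia.
    apply to_nat_pair_inj in E. destruct E as [Ef Eg].
    apply (encode_inj g Fst) in Eg. subst g.
    destruct Hz as (v & Hv & Hz). cbn [eval] in Hv.
    rewrite pi1_pair in Hv. subst v. exists f. split; [exact Ef|now exists z].
  (* [Comp c Fst] ignores the premise of an axiom, so over the empty oracle the empty premise, with
     index [0], can be used. *)
  - intros (c & <- & z & Hz). exists (5 + 4 * ⟨encode c, 2⟩), y.
    split; [easy|]. exists 0. split; [intros k Hk; now apply D_0 in Hk|].
    exists (Comp c Fst). split; [easy|]. exists z, y.
    split; [cbn [eval]; now rewrite pi1_pair|exact Hz].
Qed.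

(** [O] is a parameter so that the same predicate runs with the true [zero_jump] and with a finite
    set [D u]. Bounding the query confines each stage to a finite part of the oracle. *)
Definition W_stage (O : natset) (m i y : nat) : Prop :=
  W_query i y < m /\ O (2 * W_query i y).

(** With the true oracle this approximates [Gamma a zero_jump], the form in which [A] and [B] are
    given; [Gamma_stage] stacks the operator with index [i] on top. *)
Definition set_stage (O : natset) (m a z : nat) : Prop :=
  exists w, w < m /\ W_stage O m a ⟨z, w⟩ /\ forall k, k < w -> D w k -> O k.

Definition Gamma_stage (O : natset) (m a i y : nat) : Prop :=
  exists u, u < m /\ W_stage O m i ⟨y, u⟩ /\
    forall z, z < u -> D u z -> set_stage O m a z.

Lemma W_stage_mono m m' i y :
  W_stage zero_jump m i y -> m <= m' -> W_stage zero_jump m' i y.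
Proof. intros [H H'] L. split; [lia|easy]. Qed.

Lemma set_stage_mono m m' a z :
  set_stage zero_jump m a z -> m <= m' -> set_stage zero_jump m' a z.
Proof.
  intros (w & L & Hw & H) L'. exists w. split; [lia|].
  split; [exact (W_stage_mono _ _ _ _ Hw L')|easy].
Qed.

(** The oracle stays fixed while [m] grows, so the approximation only increases and each point
    settles, as for c.e. sets. *)
Lemma Gamma_stage_mono m m' a i y :
  Gamma_stage zero_jump m a i y -> m <= m' -> Gamma_stage zero_jump m' a i y.
Proof.
  intros (u & L & Hu & H) L'. exists u. split; [lia|].
  split; [exact (W_stage_mono _ _ _ _ Hu L')|].
  intros z Lz Hz. exact (set_stage_mono _ _ _ _ (H z Lz Hz) L').
Qed.

Lemma set_stage_limit a z :
  Gamma a zero_jump z <-> exists m, set_stage zero_jump m a z.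
Proof.
  split.
  - intros (w & Hw & H). apply zero_jump_W_query in H.
    exists (S (w + W_query a ⟨z, w⟩)), w. split; [lia|].
    split; [split; [lia|easy]|]. auto.
  - intros (m & w & _ & [_ H] & Hw). exists w. split.
    + intros k Hk. apply Hw; [now apply D_lt|easy].
    + now apply zero_jump_W_query.
Qed.

Lemma Gamma_stage_limit A a i y :
  set_eq A (Gamma a zero_jump) ->
  Gamma i A y <-> exists m, Gamma_stage zero_jump m a i y.
Proof.
  intros EA. split.
  - intros (u & Hu & H). apply zero_jump_W_query in H.
    destruct (bounded_uniform
      (fun z m => D u z -> set_stage zero_jump m a z) u) as [m Hm].
    + intros z s t Hs L Hz. exact (set_stage_mono _ _ _ _ (Hs Hz) L).
    + intros z _. destruct (classic (D u z)) as [Hz|Hz]; [|now exists 0].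
      apply Hu, EA, set_stage_limit in Hz. destruct Hz. eauto.
    + exists (S (u + W_query i ⟨y, u⟩ + m)), u. split; [lia|].
      split; [split; [lia|easy]|].
      intros z L Hz. apply (set_stage_mono m); [auto|lia].
  - intros (m & u & _ & [_ H] & Hu). exists u. split.
    + intros z Hz. apply EA, set_stage_limit. exists m.
      apply Hu; [now apply D_lt|easy].
    + now apply zero_jump_W_query.
Qed.

(* The stage [m] only queries the oracle below [2 * m]. *)
Lemma Gamma_stage_local O O' m a i y :
  (forall k, k < 2 * m -> O k -> O' k) ->
  Gamma_stage O m a i y -> Gamma_stage O' m a i y.
Proof.
  intros HO.
  assert (HW : forall e z, W_stage O m e z -> W_stage O' m e z).
  { intros e z [L H]. split; [easy|]. apply HO; [lia|easy]. }
  intros (u & L & Hu & H). exists u. split; [easy|]. split; [auto|].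
  intros z Lz Hz. destruct (H z Lz Hz) as (w & Lw & Hw & H').
  exists w. split; [easy|]. split; [auto|].
  intros k Lk Hk. apply HO; [lia|auto].
Qed.

(** * Length of agreement and the sets it enumerates *)

(** The bound [x < m] keeps the contribution of each single stage finite. *)
Definition agree (O : natset) (m a b n x : nat) : Prop :=
  x < m /\
  (forall y, y < S x ->
    (Gamma_stage O m a (pi1 n) y <-> Gamma_stage O m b (pi2 n) y)) /\
  Gamma_stage O m a (pi1 n) x.

Definition common_part (a b n : nat) : natset :=
  fun x => exists m, agree zero_jump m a b n x.

(** The equivalence inside [agree] is not monotone in the oracle. Hence, unlike in
    [Gamma_stage_local], the two oracles must coincide below [2 * m]. *)
Lemma agree_local O O' m a b n x :
  (forall k, k < 2 * m -> (O k <-> O' k)) ->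
  agree O m a b n x -> agree O' m a b n x.
Proof.
  intros HO (L & H & Hx). split; [easy|].
  assert (HG : forall c i y,
    Gamma_stage O m c i y <-> Gamma_stage O' m c i y).
  { intros c i y. split; apply Gamma_stage_local; intros k Lk; now apply HO. }
  split; [|now apply HG].
  intros y Ly. rewrite <- !HG. auto.
Qed.

(** [zero_jump] joins a set with its complement, so it contains exactly one of [2 * k] and
    [2 * k + 1]. A finite subset meeting each such pair up to [m] thus also carries the negative
    information below [2 * m]. *)
Lemma deciding_subset u m :
  (forall k, D u k -> zero_jump k) ->
  (forall k, k < m -> D u (2 * k) \/ D u (2 * k + 1)) ->
  forall k, k < 2 * m -> (D u k <-> zero_jump k).
Proof.
  intros Hu Hm k L. split; [auto|]. intros Hk.
  destruct (Nat.Even_or_Odd k) as [[j ->]|[j ->]];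
    destruct (Hm j ltac:(lia)) as [H|H]; auto; exfalso; apply Hu in H;
    rewrite zero_jump_even in *; rewrite zero_jump_odd in *; auto.
Qed.

(** An enumeration operator sees only positive information, so the test is run with [D u] as oracle,
    and only when [D u] decides every pair below [2 * m]. The index then comes from [smn]. *)
Lemma common_part_uniform a b :
  exists f, computable f /\
    forall n, set_eq (common_part a b n) (Gamma (f n) zero_jump).
Proof.
  (* Here [p] stands for [⟨n, ⟨x, u⟩⟩]: the parameter, then an axiom. *)
  assert (HG : ce (fun p => exists m,
    (forall k, k < m ->
      D (pi2 (pi2 p)) (2 * k) \/ D (pi2 (pi2 p)) (2 * k + 1)) /\
    agree (D (pi2 (pi2 p))) m a b (pi1 p) (pi1 (pi2 p)))).
  { apply ce_projection.
    unfold agree, Gamma_stage, set_stage, W_stage, W_query. decide_struct. }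
  destruct HG as [c Hc]. destruct (smn c) as (f & Hf & E).
  exists f. split; [exact Hf|]. intros n x. split.
  - intros [m Hm]. destruct (bounded_set_code zero_jump (2 * m)) as [u Hu].
    exists u. split; [intros z Hz; now apply Hu in Hz|].
    apply E, Hc. exists m. rewrite !pi2_pair, !pi1_pair. split.
    + intros k L. rewrite !Hu, zero_jump_even, zero_jump_odd.
      destruct (classic (K empty k)); [left|right]; split; auto; lia.
    + apply (agree_local zero_jump); [|exact Hm].
      intros k L. rewrite Hu. tauto.
  - intros (u & Hu & H). apply E, Hc in H. destruct H as (m & Hm & H).
    rewrite !pi2_pair, !pi1_pair in *. exists m.
    exact (agree_local _ _ _ _ _ _ _ (deciding_subset u m Hu Hm) H).
Qed.

Lemma common_part_eq A B a b n :
  set_eq A (Gamma a zero_jump) -> set_eq B (Gamma b zero_jump) ->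
  set_eq (Gamma (pi1 n) A) (Gamma (pi2 n) B) ->
  set_eq (common_part a b n) (Gamma (pi1 n) A).
Proof.
  intros EA EB H x. split.
  - intros (m & _ & _ & Hm). apply (Gamma_stage_limit _ _ _ _ EA). eauto.
  - intros Hx. apply (Gamma_stage_limit _ _ _ _ EA) in Hx as Hm.
    destruct Hm as [m Hm].
    (* Agreement at a stage may be lost later; asking for it at all stages from [s] on gives a
       monotone condition, as [bounded_uniform] requires. *)
    destruct (bounded_uniform (fun y s => forall t, s <= t ->
      (Gamma_stage zero_jump t a (pi1 n) y <->
       Gamma_stage zero_jump t b (pi2 n) y)) (S x)) as [s Hs].
    + intros y s t Hs L t' L'. apply Hs. lia.
    + intros y _. destruct (classic (Gamma (pi1 n) A y)) as [Hy|Hy].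
      * apply H in Hy as Hy'.
        apply (Gamma_stage_limit _ _ _ _ EA) in Hy.
        apply (Gamma_stage_limit _ _ _ _ EB) in Hy'.
        destruct Hy as [s Hs], Hy' as [s' Hs'].
        exists (s + s'). intros t L. split; intros _.
        -- apply (Gamma_stage_mono _ _ _ _ _ Hs'). lia.
        -- apply (Gamma_stage_mono _ _ _ _ _ Hs). lia.
      * exists 0. intros t _. split; intros Ht; exfalso; apply Hy.
        -- apply (Gamma_stage_limit _ _ _ _ EA). eauto.
        -- apply H, (Gamma_stage_limit _ _ _ _ EB). eauto.
    + exists (S (x + m + s)). split; [lia|]. split.
      * intros y L. apply Hs; lia.
      * apply (Gamma_stage_mono _ _ _ _ _ Hm). lia.
Qed.

(* Once a difference is enumerated, agreement beyond it is lost for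
   ever, and each earlier stage contributes only finitely many elements. *)
Lemma common_part_bounded A B a b n :
  set_eq A (Gamma a zero_jump) -> set_eq B (Gamma b zero_jump) ->
  ~ set_eq (Gamma (pi1 n) A) (Gamma (pi2 n) B) ->
  exists r, forall x, common_part a b n x -> x < r.
Proof.
  intros EA EB H.
  apply not_all_ex_not in H. destruct H as [d Hd].
  (* [d] lies in exactly one of the two limits. Once that side has shown it, agreement at [d] would
     put it into the other limit as well. *)
  assert (Hs : exists s, forall t, s <= t ->
    ~ (Gamma_stage zero_jump t a (pi1 n) d <->
       Gamma_stage zero_jump t b (pi2 n) d)).
  { rewrite (Gamma_stage_limit _ _ _ _ EA), (Gamma_stage_limit _ _ _ _ EB) in Hd.
    destruct (classic (exists m, Gamma_stage zero_jump m a (pi1 n) d))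
      as [[s Hs]|N].
    - exists s. intros t L [Ht _]. apply Hd. split; eauto.
      intros _. exists t. apply Ht. exact (Gamma_stage_mono _ _ _ _ _ Hs L).
    - destruct (classic (exists m, Gamma_stage zero_jump m b (pi2 n) d))
        as [[s Hs]|N']; [|tauto].
      exists s. intros t L [_ Ht]. apply N. exists t. apply Ht.
      exact (Gamma_stage_mono _ _ _ _ _ Hs L). }
  (* An element [x >= d] enumerated at a stage [m >= s] would need agreement at [d]; so either
     [x < d] or [x < m < s]. *)
  destruct Hs as [s Hs]. exists (S (d + s)). intros x (m & L & Hm & _).
  destruct (Nat.lt_ge_cases x d) as [Lx|Lx]; [lia|].
  destruct (Nat.lt_ge_cases m s) as [Lm|Lm]; [lia|].
  exfalso. apply (Hs m Lm), Hm. lia.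
Qed.

(** The case distinction is classical: only the listing has to be computable, while the reductions
    to [A] and [B] merely have to exist. *)
Lemma common_part_e_le A B a b n :
  set_eq A (Gamma a zero_jump) -> set_eq B (Gamma b zero_jump) ->
  e_le (common_part a b n) A /\ e_le (common_part a b n) B.
Proof.
  intros EA EB.
  destruct (classic (set_eq (Gamma (pi1 n) A) (Gamma (pi2 n) B))) as [H|H].
  - pose proof (common_part_eq _ _ _ _ _ EA EB H) as E.
    split; apply e_le_Gamma.
    + now exists (pi1 n).
    + exists (pi2 n). intros x. now rewrite (E x), (H x).
  - destruct (common_part_bounded _ _ _ _ _ EA EB H) as [r Hr].
    split; exact (e_le_bounded _ _ r Hr).
Qed.

(** * From Ahmad pairs to the listing *)

(** If [X] lay below [B] and above [A], transitivity would put [A] below [B]. *)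
Lemma ahmad_pair_e_lt A B X :
  ahmad_pair A B -> (e_lt X A <-> e_le X A /\ e_le X B).
Proof.
  intros [HN H]. split.
  - intros HX. split; [apply HX|now apply H].
  - intros [HA HB]. split; [exact HA|]. intros HX.
    exact (HN (e_le_trans _ _ _ HX HB)).
Qed.

Lemma e_le_ext X Y A : set_eq X Y -> e_le Y A -> e_le X A.
Proof.
  intros E (G & HG & HY). exists G. split; [exact HG|]. intros x.
  now rewrite (E x).
Qed.

Theorem theorem3p3 (A B : natset) (hA : sigma2 A) (hB : sigma2 B)
  (hAB : ahmad_pair A B) :
  exists f : nat -> nat, ahmad_sequence A f.
Proof.
  apply e_le_Gamma in hA, hB. destruct hA as [a EA], hB as [b EB].
  destruct (common_part_uniform a b) as (f & Hf & E).
  exists f. split; [exact Hf|]. intros X.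
  rewrite (ahmad_pair_e_lt _ _ _ hAB). split.
  - intros [n HX].
    destruct (common_part_e_le A B a b n EA EB) as [H1 H2].
    assert (EX : set_eq X (common_part a b n))
      by (intros x; now rewrite (HX x), (E n x)).
    split; now apply (e_le_ext _ _ _ EX).
  - intros [HXA HXB]. apply e_le_Gamma in HXA, HXB.
    destruct HXA as [i Hi], HXB as [j Hj]. exists ⟨i, j⟩.
    assert (H : set_eq (common_part a b ⟨i, j⟩) (Gamma (pi1 ⟨i, j⟩) A)).
    { apply (common_part_eq A B); auto. rewrite pi1_pair, pi2_pair.
      intros x. now rewrite <- (Hi x), <- (Hj x). }
    rewrite pi1_pair in H.
    intros x. now rewrite <- (E _ x), (H x), (Hi x).
Qed.
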